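(* For every $\delta\ge1$, $$\dim_H\Big(\limsup_{B\in\mathcal{Q}}B^{\delta}\cap K_{1/3}^{(0)}\Big)=\min\Big\{\frac{\log2}{\log3},\frac1\delta\Big\}.$$
   Context: $\mathcal{Q}=\{B(\frac pq,q^{-2})\}_{q\in\mathbb{N}^*,\,0\le p\le q}$, where $B(x,r)=[x-r,x+r]\subset\mathbb{R}$; for $B=B(x,r)$, $B^\delta=B(x,r^\delta)$, so that $\limsup_{B\in\mathcal{Q}}B^\delta$ is the set of points belonging to $B(\frac pq,q^{-2\delta})$ for infinitely many pairs $(p,q)$ with $q\ge1$, $0\le p\le q$. Let $\Lambda=\{0,1,2\}$, $f_i(x)=\frac{x+i}{3}$ for $i\in\Lambda$, and let $\pi:\Lambda^{\mathbb{N}}\to[0,1]$, $\pi((x_n)_{n\ge1})=\lim_{n\to\infty}f_{x_1}\circ\cdots\circ f_{x_n}(0)=\sum_{n\ge1}x_n3^{-n}$. Let $\sigma$ be the shift on $\Lambda^{\mathbb{N}}$, and $\phi:\Lambda^{\mathbb{N}}\to\{0,1\}$ with $\phi(x)=1$ if $x_1=1$ and $\phi(x)=0$ if $x_1\in\{0,2\}$. With the Birkhoff sums $S_k\phi(x)=\sum_{j=0}^{k-1}\phi(\sigma^jx)$, $$K_{1/3}^{(0)}=\pi\Big(\Big\{x\in\Lambda^{\mathbb{N}}:\liminf_{k\to+\infty}\frac{S_k\phi(x)}{k}=0\Big\}\Big).$$ $\dim_H$ is Hausdorff dimension. *)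

(* Defs.v *)
From mathcomp Require Import all_boot all_order all_algebra.
From mathcomp Require Import all_classical all_reals all_analysis.

Set Implicit Arguments.
Unset Strict Implicit.
Unset Printing Implicit Defensive.

Import Order.TTheory GRing.Theory Num.Theory.
Import numFieldNormedType.Exports.

Local Open Scope classical_set_scope.
Local Open Scope ring_scope.

Section HausdorffDimension.
Variable R : realType.
Implicit Types (A U : set R) (s eps : R) (C : (set R)^nat).

Definition diam U : \bar R :=
  ereal_sup (0%:E |` [set `|xy.1 - xy.2|%:E | xy in U `*` U]).

(* [diam U `^ s], except that the empty set weighs 0 also when s = 0
   ([poweR] has 0 `^ 0 = 1, which is right for singletons only). *)
Definition diam_pow s U : \bar R :=
  if U == set0 then 0%E else poweR (diam U) s.

(* Finite covers are included, since the C k may be empty. *)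
Definition delta_cover eps A C : Prop :=
  A `<=` \bigcup_k C k /\ forall k, (diam (C k) <= eps%:E)%E.

Definition hausdorff_content s eps A : \bar R :=
  ereal_inf [set (\sum_(0 <= k <oo) diam_pow s (C k))%E
            | C in [set C | delta_cover eps A C]].

Definition hausdorff_measure s A : \bar R :=
  ereal_sup [set hausdorff_content s eps A | eps in [set eps | 0 < eps]].

Definition hausdorff_dim A : \bar R :=
  ereal_inf [set s%:E | s in [set s | 0 <= s /\ hausdorff_measure s A = 0%E]].

End HausdorffDimension.

Section RationalBalls.
Variable R : realType.

(* A ball is recorded by its centre and radius, so that B^delta makes sense. *)
Definition cball (B : R * R) : set R := `[B.1 - B.2, B.1 + B.2].

Definition contract (delta : R) (B : R * R) : R * R := (B.1, B.2 `^ delta).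

Definition limsup_fam (I : Type) (D : set I) (E : I -> set R) : set R :=
  [set t | infinite_set [set i | D i /\ E i t]].

(* Indices are pairs (p, q). *)
Definition rat_index : set (nat * nat) :=
  [set pq | (1 <= pq.2)%N /\ (pq.1 <= pq.2)%N].

Definition rat_ball (pq : nat * nat) : R * R :=
  (pq.1%:R / pq.2%:R, pq.2%:R ^- 2).

Definition limsup_rat_balls (delta : R) : set R :=
  limsup_fam rat_index (fun pq => cball (contract delta (rat_ball pq))).

End RationalBalls.

Section TernaryCoding.
Variable R : realType.

(* x 0 is the first letter x_1 of the word. *)
Definition word := nat -> 'I_3.

Definition shift (x : word) : word := fun n => x n.+1.

Definition ifs_map (i : 'I_3) (t : R) : R := (t + (i : nat)%:R) / 3.

(* f_{x_1} o ... o f_{x_n} *)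
Fixpoint ifs_comp (n : nat) (x : word) : R -> R :=
  if n is m.+1 then ifs_map (x 0%N) \o ifs_comp m (shift x) else id.

Definition coding (x : word) : R := limn (fun n => ifs_comp n x 0).

Definition phi (x : word) : R := if x 0%N == 1%N :> nat then 1 else 0.

Definition birkhoff_sum (psi : word -> R) (k : nat) (x : word) : R :=
  \sum_(j < k) psi (iter j shift x).

Definition K0 : set R :=
  coding @` [set x : word |
    limn_inf (fun k => birkhoff_sum phi k x / k%:R) = 0].

End TernaryCoding.

Arguments K0 R : clear implicits.

(* Main.v *)
(** Upper bound: both factors lie in limsup sets.  The balls B(p/q, q^(-2 delta))
    with q in a dyadic block, respectively the ternary cylinders of length k
    containing at most k/r letters 1 (counted by an exponential Chernoff
    weight eta^(r #1 - k)), have total s-mass decaying geometrically as soon as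
    s > 1/delta, respectively s > log 2 / log 3.

    Lower bound: for s < min(log 2 / log 3, 1/delta) we build t |-> f(t) from
    [0, 1[ to the set with |t - u| <= C |f(t) - f(u)|^s, so that Lebesgue
    measure on [0, 1[ bounds the s-mass of any cover from below.  The point f(t)
    is the limit of nested ternary cylinders chosen by the mixed-radix digits of
    t.  A rational step scales the >= Q^2/4 fractions of denominator <= 2Q, which
    are 1/(2Q)^2-separated, into the current cylinder for a huge Q, and moves to
    tiny cylinders next to them; a digit step appends a letter 0 or 2.  After a
    rational step ending at level l, l^2 digit steps follow, which brings the
    frequency of the letter 1 down to at most 1/(1+l). *)

Require Import Defs.
From mathcomp Require Import all_boot all_order all_algebra.
From mathcomp Require Import all_classical all_reals all_analysis.
From mathcomp Require Import ring lra zify.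
Set Implicit Arguments.
Unset Strict Implicit.
Unset Printing Implicit Defensive.
Import Order.TTheory GRing.Theory Num.Theory.
Import numFieldNormedType.Exports.
Local Open Scope classical_set_scope.
Local Open Scope ring_scope.

(** * Hausdorff measure *)

Section HausdorffBasics.
Variable R : realType.
Implicit Types (A B U : set R) (s eps : R).

Lemma diam_ge0 U : (0 <= diam U)%E.
Proof. by apply: ereal_sup_ubound; left. Qed.

Lemma diam_ge U (x y : R) : U x -> U y -> (`|x - y|%:E <= diam U)%E.
Proof. by move=> Ux Uy; apply: ereal_sup_ubound; right; exists (x, y). Qed.

Lemma diam_le U (h : R) : 0 <= h ->
  (forall x y, U x -> U y -> `|x - y| <= h) -> (diam U <= h%:E)%E.
Proof.
move=> h0 Uh; apply: ge_ereal_sup => _ [->|[[x y] /= [Ux Uy]] <-];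
  by rewrite lee_fin //; exact: Uh.
Qed.

Lemma diam_pow_ge0 s U : (0 <= diam_pow s U)%E.
Proof. by rewrite /diam_pow; case: ifP => // _; exact: poweR_ge0. Qed.

Lemma diam_pow_le s U (h : R) : 0 <= h -> 0 <= s ->
  (forall x y, U x -> U y -> `|x - y| <= h) -> (diam_pow s U <= (h `^ s)%:E)%E.
Proof.
move=> h0 s0 Uh; rewrite /diam_pow; case: ifP => _; first by rewrite lee_fin powR_ge0.
rewrite -poweR_EFin; apply: gt0_ler_poweR => //; last exact: diam_le.
  by rewrite in_itv /= diam_ge0 leey.
by rewrite in_itv /= lee_fin h0 leey.
Qed.

Lemma hausdorff_content_ge0 s eps A : (0 <= hausdorff_content s eps A)%E.
Proof.
apply: le_ereal_inf_tmp => _ [C _ <-].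
by apply: nneseries_ge0 => k _ _; exact: diam_pow_ge0.
Qed.

Lemma hausdorff_measure0P s A :
  hausdorff_measure s A = 0%E <->
  forall eps, 0 < eps -> hausdorff_content s eps A = 0%E.
Proof.
split=> [H eps eps0|H].
  apply/eqP; rewrite eq_le hausdorff_content_ge0 andbT -[leRHS]H.
  by apply: ereal_sup_ubound; exists eps.
apply/eqP; rewrite eq_le; apply/andP; split.
  by apply: ge_ereal_sup => _ [eps /= eps0 <-]; rewrite H.
rewrite -(H 1) //; apply: ereal_sup_ubound; exists 1 => //=.
Qed.

Lemma hausdorff_measure0S s A B :
  A `<=` B -> hausdorff_measure s B = 0%E -> hausdorff_measure s A = 0%E.
Proof.
move=> AB /hausdorff_measure0P HB; apply/hausdorff_measure0P => eps eps0.
apply/eqP; rewrite eq_le hausdorff_content_ge0 andbT -(HB eps eps0).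
apply: ereal_inf_le_tmp => _ [C [BC dC] <-]; exists C => //; split => //.
exact: subset_trans BC.
Qed.

(** Covers given level by level, finitely many sets [E k j] at each level, are flattened to a
    sequence by enumerating the countable type of pairs [(k, j)]. Indices that code no pair receive
    the empty set, which weighs 0 for every exponent. *)
Lemma hausdorff_content_le s eps A (T : nat -> finType)
    (E : forall k, T k -> set R) (w : nat -> \bar R) : 0 < eps ->
  (forall x, A x -> exists k, exists j : T k, E k j x) ->
  (forall k j, (diam (E k j) <= eps%:E)%E) ->
  (forall k, (\sum_(j : T k) diam_pow s (E k j) <= w k)%E) ->
  (hausdorff_content s eps A <= \sum_(0 <= k <oo) w k)%E.
Proof.
move=> eps0 AE dE wE.
pose S : countType := {k : nat & T k}.
pose f (u : S) := diam_pow s (E (tag u) (tagged u)).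
pose C n := if pickle_inv n is Some u then E (tag (u : S)) (tagged u) else set0.
have diam0 : diam_pow s (set0 : set R) = 0%E by rewrite /diam_pow eqxx.
apply: ge_ereal_inf; exists (\sum_(0 <= n <oo) diam_pow s (C n))%E.
  exists C => //; split=> [x /AE[k [j Ej]]|n].
    exists (pickle (Tagged T j : S)) => //.
    by rewrite /C pickleK_inv.
  rewrite /C; case: pickle_inv => [u|//]; first exact: dE.
  by apply: diam_le => //; exact: ltW.
have f0 u : (0 <= f u)%E by exact: diam_pow_ge0.
have -> : (\sum_(0 <= n <oo) diam_pow s (C n) = \esum_(u in [set: S]) f u)%E.
  rewrite nneseries_esumT; last by move=> n; exact: diam_pow_ge0.
  transitivity (\esum_(n in (@pickle S) @` setT) diam_pow s (C n)).
    rewrite [RHS]esum_mkcond; apply: eq_esum => n _; case: ifPn => //.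
    rewrite notin_setE /C; case E1 : pickle_inv => [u|] // nn.
    exfalso; apply: nn; exists u => //.
    by have := @pickle_invK S n; rewrite /oapp E1.
  rewrite esum_image; last by move=> u v _ _; exact: (pcan_inj (@pickleK S)).
  by apply: eq_esum => u _; rewrite /C pickleK_inv.
have -> : [set: S] = \bigcup_(k in [set: nat]) [set u : S | tag u = k].
  by apply/seteqP; split=> // u _; exists (tag u).
rewrite esum_bigcupT //; last by move=> i j _ _ [u [/= <- <-]].
have w0 k : (0 <= w k)%E.
  by apply: le_trans (wE k); apply: sume_ge0 => j _; exact: diam_pow_ge0.
rewrite nneseries_esumT //; apply: le_esum => k _.
apply: le_trans (wE k).
have -> : [set u : S | tag u = k] = (@Tagged _ k T) @` [set: T k].
  apply/seteqP; split=> [[i j] /= ik|_ [j _ <-] //].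
  by case: _ / ik; exists j.
rewrite esum_image; last first.
  by move=> i j _ _ /eqP; rewrite -tag_eqE /tag_eq eqxx /= tagged_asE => /eqP.
rewrite esum_fset; [|exact: finite_finset|by move=> *; exact: f0].
rewrite (_ : [set: T k] = [set` enum (T k)]).
  by rewrite -fsbig_seq ?enum_uniq // big_enum.
by apply/seteqP; split=> // j _ /=; rewrite mem_enum.
Qed.

End HausdorffBasics.

(** * Null measure of limsup sets, in the manner of Borel-Cantelli *)

Section LimsupNull.
Variable R : realType.

(** The levels from [K] on already cover [A]. Their mass is at most the geometric tail
    [c * rho ^+ K / (1 - rho)], and their diameters become smaller than any [eps]. *)
Lemma hausdorff_measure_limsup0 (s : R) (A : set R) (T : nat -> finType)
    (E : forall k, T k -> set R) (r : nat -> R) (c rho : R) :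
  0 <= c -> 0 < rho < 1 ->
  (forall x, A x -> forall K, exists k, (K <= k)%N /\ exists j : T k, E k j x) ->
  (r @ \oo --> (0 : R)) ->
  (forall k j, (diam (E k j) <= (r k)%:E)%E) ->
  (forall k, (\sum_(j : T k) diam_pow s (E k j) <= (c * rho ^+ k)%:E)%E) ->
  hausdorff_measure s A = 0%E.
Proof.
move=> c0 /andP[rho0 rho1] AE r0 dE wE; apply/hausdorff_measure0P => eps eps0.
apply/eqP; rewrite eq_le hausdorff_content_ge0 andbT.
apply/lee_addgt0Pr => e e0; rewrite add0e.
have rho1' : `|rho| < 1 by rewrite gtr0_norm.
have [K1 _ HK1] : \forall k \near \oo, r k <= eps.
  move/cvgrPdist_le : r0 => /(_ _ eps0); apply: filterS => k.
  by rewrite sub0r normrN => /ler_normlW.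
have [K2 _ HK2] : \forall k \near \oo, geometric (c / (1 - rho)) rho k <= e.
  move/cvgrPdist_le : (cvg_geometric (c / (1 - rho)) rho1') => /(_ _ e0).
  by apply: filterS => k; rewrite sub0r normrN => /ler_normlW.
pose K := maxn K1 K2.
have ckr k : 0 <= c * rho ^+ k by rewrite mulr_ge0 // exprn_ge0 // ltW.
apply: (@le_trans _ _ (\sum_(0 <= k <oo) (c * rho ^+ (K + k))%:E)%E).
  apply: (hausdorff_content_le (E := fun k (j : T (K + k)%N) => E (K + k)%N j)) => //.
  - move=> x /AE /(_ K) [k [Kk [j Ej]]].
    exists (k - K)%N; have := subnKC Kk; move: (k - K)%N => k' Hk.
    by case: _ / Hk in j Ej *; exists j.
  - move=> k j; apply: le_trans (dE _ j) _; rewrite lee_fin; apply: HK1 => /=.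
    exact: leq_trans (leq_maxl _ _) (leq_addr _ _).
apply: lime_le.
  by apply: is_cvg_nneseries => n _ _; rewrite lee_fin.
apply: nearW => n; rewrite sumEFin lee_fin.
apply: le_trans (HK2 K (leq_maxr _ _)).
have -> : \sum_(0 <= k < n) c * rho ^+ (K + k) = series (geometric (c * rho ^+ K) rho) n.
  by rewrite /series /=; apply: eq_bigr => k _; rewrite exprD mulrA.
apply: le_trans (geometric_le_lim _ (ckr K) rho0 rho1') _.
by rewrite /= mulrAC.
Qed.

Lemma divr_powR_lt1 (a b s : R) : 0 < a -> 1 < b -> ln a / ln b < s -> a / b `^ s < 1.
Proof.
move=> a0 b1; have b0 : 0 < b by apply: lt_trans b1.
rewrite ltr_pdivrMr ?ln_gt0 // => h.
rewrite ltr_pdivrMr ?powR_gt0 // mul1r -ltr_ln ?posrE ?powR_gt0 //.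
by rewrite ln_powR.
Qed.

(** Since [p <= q] in [rat_index], a bound on the denominators would leave only finitely many
    pairs. *)
Lemma rat_pairs_unbounded (A : set (nat * nat)) :
  infinite_set A -> A `<=` rat_index -> forall K, exists pq, A pq /\ (K <= pq.2)%N.
Proof.
move=> Ainf Asub K; apply: contrapT => H; apply: Ainf.
apply: (@sub_finite_set _ _ [set pq : nat * nat | (pq.1 < K.+1)%N /\ (pq.2 < K.+1)%N]).
  move=> [p q] Apq /=; have := Asub _ Apq; rewrite /rat_index /= => -[_ pq].
  have qK : (q < K)%N.
    by rewrite ltnNge; apply/negP => Kq; apply: H; exists (p, q).
  by split; rewrite ltnS; [apply: leq_trans pq (ltnW qK)|exact: ltnW].
exact: (finite_setX (finite_II K.+1) (finite_II K.+1)).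
Qed.

End LimsupNull.

(** * Upper bounds *)

Section RationalUpper.
Variable R : realType.

Lemma powR_exprn (x a : R) (k : nat) : 0 <= x -> (x ^+ k) `^ a = (x `^ a) ^+ k.
Proof. by move=> x0; rewrite -!powR_mulrn ?powR_ge0 // powRAC. Qed.

Lemma sum_EFin_const_le (T : finType) (F : T -> \bar R) (c : R) :
  (forall j, (F j <= c%:E)%E) -> (\sum_j F j <= (#|T|%:R * c)%:E)%E.
Proof.
move=> Fc; apply: (@le_trans _ _ (\sum_(j : T) c%:E)%E); first exact: lee_sum.
by rewrite sumEFin lee_fin sumr_const mulr_natl.
Qed.

Lemma dist_cball_le (B : R * R) (x y : R) :
  cball B x -> cball B y -> `|x - y| <= 2 * B.2.
Proof.
rewrite /cball /= !in_itv /= => /andP[x1 x2] /andP[y1 y2].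
by rewrite ler_norml; apply/andP; split; lra.
Qed.

Lemma hausdorff_measure_limsup_rat (delta s : R) :
  1 <= delta -> 1 / delta < s -> hausdorff_measure s (limsup_rat_balls delta) = 0%E.
Proof.
move=> d1 ds; have d0 : 0 < delta by apply: lt_le_trans d1.
have s0 : 0 < s by apply: lt_trans ds; rewrite divr_gt0.
pose T k : finType := ('I_(2 ^ k.+1) * 'I_(2 ^ k.+1))%type.
pose E k (j : T k) : set R := if (2 ^ k <= j.2)%N
  then cball (Defs.contract delta (rat_ball R (j.1 : nat, j.2 : nat))) else set0.
pose rho1 : R := 4^-1 `^ delta.
have rho1_gt0 : 0 < rho1 by rewrite powR_gt0 // invr_gt0.
have rho1_lt1 : rho1 < 1.
  apply: (@le_lt_trans _ _ 4^-1); last by rewrite invf_lt1 // ltr1n.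
  by apply: ge1r_powR => //; rewrite invr_gt0 ltr0n /= invf_le1 // ler1n.
have rk_ge0 k : 0 <= 2 * rho1 ^+ k by rewrite mulr_ge0 // exprn_ge0 // ltW.
have dE k (j : T k) x y : E k j x -> E k j y -> `|x - y| <= 2 * rho1 ^+ k.
  rewrite /E; case: ifP => // kj /dist_cball_le h /h {h} h; apply: le_trans h _.
  rewrite ler_pM2l //= -powR_exprn ?invr_ge0 //.
  have q0 : 0 < (j.2 : nat)%:R :> R.
    by rewrite ltr0n; apply: leq_trans kj; rewrite expn_gt0.
  apply: ge0_ler_powR; rewrite ?nnegrE ?invr_ge0 ?exprn_ge0 ?(ltW d0) //=.
  rewrite exprVn lef_pV2 ?posrE ?exprn_gt0 //.
  rewrite (_ : 4 = 2 ^+ 2 :> R); last by rewrite expr2; lra.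
  rewrite -exprM mulnC exprM lerXn2r ?nnegrE ?exprn_ge0 ?(ltW q0) //.
  by rewrite -natrX ler_nat.
apply: (@hausdorff_measure_limsup0 R s _ T E (fun k => 2 * rho1 ^+ k)
          (4 * 2 `^ s) (4 * rho1 `^ s)).
- by rewrite mulr_ge0 // powR_ge0.
- apply/andP; split; first by rewrite mulr_gt0 // powR_gt0.
  rewrite /rho1 -powRrM -powR_inv1 // -powRrM mulN1r powRN.
  apply: divr_powR_lt1; rewrite ?ltr1n //.
  by rewrite divff ?gt_eqF ?ln_gt0 ?ltr1n // -ltr_pdivrMl // mulrC.
- move=> x /rat_pairs_unbounded Hx K.
  have /Hx {Hx} Hx : [set i | rat_index i /\ cball (Defs.contract delta (rat_ball R i)) x] `<=` rat_index.
    by move=> i [].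
  have [[p q] [[/= [/= q1 pq] Bx] /= Kq]] := Hx (2 ^ K)%N.
  exists (trunc_log 2 q); split; first by rewrite -(trunc_expnK K (isT : 1 < 2)%N) leq_trunc_log.
  have /andP[l1 l2] := trunc_log_bounds (isT : 1 < 2)%N q1.
  exists (Ordinal (leq_ltn_trans pq l2), Ordinal l2).
  by rewrite /E /= l1.
- have := @cvg_geometric R 2 rho1; rewrite ger0_norm ?ltW //; exact.
- move=> k j; apply: diam_le => //; exact: dE.
- move=> k; apply: (le_trans (sum_EFin_const_le (c := (2 * rho1 ^+ k) `^ s) _)).
    by move=> j; apply: diam_pow_le => //; [exact: ltW|exact: dE].
  rewrite lee_fin card_prod card_ord powRM ?exprn_ge0 ?(ltW rho1_gt0) //.
  rewrite powR_exprn ?(ltW rho1_gt0) // exprMn -expnMn natrX exprS.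
  rewrite [leRHS](_ : _ = 4 * 4 ^+ k * (2 `^ s * (rho1 `^ s) ^+ k)) ?lexx //; ring.
Qed.

End RationalUpper.

(** * Ternary cylinders and the frequency condition *)

Section Coding.
Variable R : realType.
Implicit Types (x : word) (t : R).

Lemma ifs_compE n x t :
  ifs_comp n x t = \sum_(j < n) (x j : nat)%:R / 3 ^+ j.+1 + t / 3 ^+ n.
Proof.
elim: n x => [|n IH] x; first by rewrite big_ord0 add0r expr0 divr1.
rewrite /= IH /ifs_map big_ord_recl /= expr1 mulrDl mulrDl mulr_suml.
rewrite addrAC; congr (_ + _); last by rewrite -mulrA -invfM -exprSr.
rewrite addrC; congr (_ + _).
by apply: eq_bigr => j _; rewrite /= -mulrA -invfM -exprSr.
Qed.

Lemma iter_shift j x n : iter j Defs.shift x n = x (j + n)%N.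
Proof. by elim: j x n => [//|j IH] x n; rewrite iterS {1}/Defs.shift IH addnS. Qed.

Lemma birkhoff_sum_phi k x :
  birkhoff_sum (@phi R) k x = (\sum_(j < k) (x j == 1%N :> nat))%:R.
Proof.
rewrite /birkhoff_sum natr_sum; apply: eq_bigr => j _.
by rewrite /phi iter_shift addn0; case: eqP.
Qed.

Lemma ifs_comp_mono x (m n : nat) : (m <= n)%N ->
  ifs_comp m x 0 <= ifs_comp n x 0 :> R /\
  ifs_comp n x 0 + 3 ^- n <= ifs_comp m x 0 + 3 ^- m :> R.
Proof.
elim: n => [|n IH]; first by rewrite leqn0 => /eqP ->.
rewrite leq_eqVlt => /orP[/eqP -> //|/IH [h1 h2]].
have e : ifs_comp n.+1 x 0 = ifs_comp n x 0 + (x n : nat)%:R / 3 ^+ n.+1 :> R.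
  by rewrite !ifs_compE !mul0r !addr0 big_ord_recr.
rewrite e; split.
  by apply: le_trans h1 _; rewrite lerDl divr_ge0 // exprn_ge0.
apply: le_trans h2; rewrite -addrA lerD2l -{2}(mul1r (3 ^- n.+1)) -mulrDl.
rewrite exprS invfM mulrA ler_piMl ?invr_ge0 ?exprn_ge0 //.
rewrite ler_pdivrMr // mul1r natr1 ler_nat.
exact: ltn_ord.
Qed.

Lemma coding_bounds n x :
  ifs_comp n x 0 <= coding R x <= ifs_comp n x 0 + 3 ^- n.
Proof.
have ndec : {homo (fun m => ifs_comp m x 0 : R) : a b / (a <= b)%N >-> a <= b}.
  by move=> a b /(ifs_comp_mono x) [].
have cv : cvgn (fun m => ifs_comp m x 0 : R).
  apply: nondecreasing_is_cvgn => //; exists (ifs_comp 0 x 0 + 3 ^- 0) => _ [m _ <-].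
  have [_] := ifs_comp_mono x (leq0n m); apply: le_trans.
  by rewrite lerDl invr_ge0 exprn_ge0.
apply/andP; split; first exact: nondecreasing_cvgn_le.
apply: limr_le => //; exists n => // m /= nm.
have [_] := ifs_comp_mono x nm; apply: le_trans.
by rewrite lerDl invr_ge0 exprn_ge0.
Qed.

Lemma limn_inf_eq0P (u : R^nat) : (forall k, 0 <= u k <= 1) ->
  limn_inf u = 0 <->
  forall e, 0 < e -> forall K, exists k, (K <= k)%N /\ u k < e.
Proof.
move=> u01; split=> [u0 e e0 K|H].
  have bu : bounded_fun u.
    exists 1; split => // y y1 k _; apply: le_trans (ltW y1).
    by have /andP[a b] := u01 k; rewrite ger0_norm.
  rewrite limn_infE // in u0.
  have : inf (sdrop u K) <= 0.
    rewrite -u0; apply: ub_le_sup; last by exists K.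
    exists 1 => _ [m _ <-]; apply: le_trans (proj2 (andP (u01 m))).
    apply: ge_inf; last by exists m => /=.
    by exists 0 => _ [k _ <-]; have /andP[] := u01 k.
  move/le_lt_trans => /(_ _ e0) ltK.
  have [|_ [k /= Kk <-] ue] := inf_lt _ ltK; first by exists (u K), K => /=.
  by exists k.
have infs0 n : infs u n = 0.
  apply/eqP; rewrite eq_le; apply/andP; split.
    apply/ler_addgt0Pr => e e0; have [k [nk ue]] := H e e0 n.
    rewrite add0r; apply: le_trans (ltW ue); apply: ge_inf; last by exists k.
    by exists 0 => _ [m _ <-]; have /andP[] := u01 m.
  apply: lb_le_inf; first by exists (u n), n => /=.
  by move=> _ [m _ <-]; have /andP[] := u01 m.
rewrite /limn_inf (_ : infs u = fun=> 0); last by apply/funext.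
exact: lim_cst.
Qed.

(** Frequencies below [e] are traded for integer inequalities with [r] in the role of [1 / e], so
    that the constructions can count letters in [nat]. *)
Lemma K0P (t : R) : K0 R t <-> exists2 x : word, coding R x = t &
  forall r K : nat, exists k, (K <= k)%N /\
    (r * \sum_(j < k) (x j == 1%N :> nat) <= k)%N.
Proof.
have u01 x k : 0 <= birkhoff_sum (@phi R) k x / k%:R <= 1.
  rewrite birkhoff_sum_phi; apply/andP; split; first by rewrite divr_ge0.
  case: k => [|k]; first by rewrite invr0 mulr0.
  rewrite ler_pdivrMr ?ltr0n // mul1r ler_nat.
  apply: (@leq_trans (\sum_(j < k.+1) 1)%N); last by rewrite sum1_card card_ord.
  by apply: leq_sum => i _; case: eqP.
split=> [[x /= /limn_inf_eq0P H <-]|[x <- H]].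
  (* [r.+1] keeps the threshold meaningful for [r = 0], and [K.+1] excludes [k = 0], where the
     quotient is 0 by the convention on division. *)
  exists x => // r K; have [|k [Kk uk]] := H (u01 x) (r.+1%:R^-1) _ K.+1.
    by rewrite invr_gt0.
  exists k; split; first exact: ltnW.
  move: uk; rewrite birkhoff_sum_phi ltr_pdivrMr ?ltr0n; last exact: leq_ltn_trans Kk.
  rewrite ltr_pdivlMl ?ltr0n // -natrM ltr_nat => /ltnW; apply: leq_trans.
  by rewrite leq_mul2r leqnSn orbT.
exists x => //=; apply/limn_inf_eq0P => // e e0 K.
have [k [Kk uk]] := H (Num.truncn e^-1).+1 K.+1; exists k; split; first exact: ltnW.
have k0 : (0 < k)%N by exact: leq_ltn_trans Kk.
rewrite birkhoff_sum_phi ltr_pdivrMr ?ltr0n //.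
rewrite -ltr_pdivrMl //; apply: lt_le_trans (_ : k%:R <= _); last by [].
case: (posnP (\sum_(j < k) (x j == 1%N :> nat))) => [-> |S0]; first by rewrite mulr0 ltr0n.
apply: (@lt_le_trans _ _ ((Num.truncn e^-1).+1%:R * (\sum_(j < k) (x j == 1%N :> nat))%:R)).
  by rewrite ltr_pM2r ?ltr0n // truncnS_gt.
by rewrite -natrM ler_nat.
Qed.

End Coding.

(** * The words with few letters 1 *)

Section TernaryUpper.
Variable R : realType.

(** A cylinder kept at level [k] has weight [eta ^+ (r * ones) / eta ^+ k >= 1]. Inserting this
    weight and summing over all words of length [k] gives a product over the letters, namely
    [rho ^+ k] with [rho = (2 + eta ^+ r) / (eta * z)]. *)
Lemma hausdorff_measure_K0 (s : R) :
  ln 2 / ln 3 < s -> hausdorff_measure s (K0 R) = 0%E.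
Proof.
move=> hs.
have s0 : 0 < s by apply: lt_trans hs; rewrite divr_gt0 ?ln_gt0 ?ltr1n.
pose z : R := 3 `^ s; have z0 : 0 < z by rewrite powR_gt0.
have z2 : 2 < z.
  rewrite -[2]mul1r -ltr_pdivlMr //.
  have := @divr_powR_lt1 R 2 3 s; rewrite -/z ltr1n ltr0n => /(_ isT isT hs) h.
  by rewrite ltr_pdivrMr // mul1r in h; rewrite ltr_pdivlMr // mul1r.
(* Any [eta] strictly between [2 / z] and 1 works: [eta * z > 2] leaves room for [eta ^+ r] once [r]
   is large, which makes [rho < 1]. *)
pose eta : R := (2 / z + 1) / 2.
have zV : 2 / z < 1 by rewrite ltr_pdivrMr // mul1r.
have zV0 : 0 < 2 / z by rewrite divr_gt0.
have eta0 : 0 < eta by rewrite /eta; lra.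
have eta1 : eta < 1 by rewrite /eta; lra.
have etaz : 2 < eta * z.
  by rewrite -ltr_pdivrMr // /eta; lra.
have [r hr] : exists r : nat, eta ^+ r < eta * z - 2.
  have e1 : `|eta| < 1 by rewrite gtr0_norm.
  have := cvg_geometric 1 e1; move/cvgrPdist_lt => /(_ (eta * z - 2)) [].
    by rewrite subr_gt0.
  move=> r _ /(_ r (leqnn r)) /=; rewrite sub0r normrN mul1r => /ltr_normlW h.
  by exists r.
clearbody eta.
pose rho := (2 + eta ^+ r) / (eta * z).
have ez0 : 0 < eta * z by rewrite mulr_gt0.
have er0 : 0 < eta ^+ r by rewrite exprn_gt0.
have rho01 : 0 < rho < 1.
  rewrite /rho divr_gt0 ?addr_gt0 //= ltr_pdivrMr // mul1r; lra.
pose T k : finType := {ffun 'I_k -> 'I_3}.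
pose ones k (v : T k) := (\sum_(j < k) (v j == 1%N :> nat))%N.
pose a k (v : T k) : R := \sum_(j < k) (v j : nat)%:R / 3 ^+ j.+1.
pose E k (v : T k) : set R := if (r * ones k v <= k)%N
  then `[a k v, a k v + 3 ^- k]%classic else set0.
have k3 k : 0 <= (3 ^- k : R) by rewrite invr_ge0 exprn_ge0.
have dE k (v : T k) x y : E k v x -> E k v y -> `|x - y| <= 3 ^- k.
  rewrite /E; case: ifP => // _; rewrite /= !in_itv /= => /andP[x1 x2] /andP[y1 y2].
  by rewrite ler_norml; apply/andP; split; lra.
apply: (@hausdorff_measure_limsup0 R s _ T E (fun k => 3 ^- k) 1 rho) => //.
- move=> _ /K0P[x <- Hx] K; have [k [Kk rk]] := Hx r K.
  exists k; split => //; exists [ffun j : 'I_k => x j].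
  have e1 : ones k [ffun j : 'I_k => x j] = (\sum_(j < k) (x j == 1%N :> nat))%N.
    by apply: eq_bigr => j _; rewrite ffunE.
  have e2 : a k [ffun j : 'I_k => x j] = ifs_comp k x 0.
    by rewrite ifs_compE mul0r addr0; apply: eq_bigr => j _; rewrite ffunE.
  by rewrite /E e1 rk e2 /= in_itv /= coding_bounds.
- have h3 : `|3^-1 : R| < 1 by rewrite ger0_norm // invf_lt1 // ltr1n.
  have := cvg_geometric 1 h3; apply: cvg_trans; apply: near_eq_cvg.
  by apply: nearW => n; rewrite /= mul1r exprVn.
- move=> k v; apply: diam_le => //; exact: dE.
move=> k; rewrite mul1r.
have dpE (v : T k) : (diam_pow s (E k v) <=
    ((\prod_(j < k) (if (v j == 1%N :> nat) then eta ^+ r else 1)) * (eta * z) ^- k)%:E)%E.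
  have -> : \prod_(j < k) (if (v j == 1%N :> nat) then eta ^+ r else 1) = eta ^+ (r * ones k v).
    rewrite exprM /ones (big_morph _ (exprD (eta ^+ r)) (expr0 _)).
    by apply: eq_bigr => j _; case: eqP; rewrite ?expr1 ?expr0.
  have p0 : 0 <= eta ^+ (r * ones k v) * (eta * z) ^- k.
    by rewrite mulr_ge0 ?invr_ge0 ?exprn_ge0 // ltW.
  rewrite {1}/E; case: ifPn => rk; last first.
    by rewrite /diam_pow eqxx lee_fin.
  have dU x y : `[a k v, a k v + 3 ^- k]%classic x -> `[a k v, a k v + 3 ^- k]%classic y -> `|x - y| <= 3 ^- k.
    by have := dE k v x y; rewrite /E rk.
  apply: le_trans (diam_pow_le (k3 k) (ltW s0) dU) _; rewrite lee_fin.
  rewrite -exprVn powR_exprn ?invr_ge0 // -powR_inv1 // -powRrM mulN1r powRN -/z.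
  rewrite exprMn.
  rewrite invfM mulrA exprVn ler_peMl ?invr_ge0 ?exprn_ge0 ?(ltW z0) //.
  by rewrite ler_pdivlMr ?exprn_gt0 // mul1r ler_wiXn2l ?(ltW eta0) ?(ltW eta1).
apply: le_trans (lee_sum _ (fun v _ => dpE v)) _.
(* The sum over words of a product over positions is the [k]-th power of the one-letter sum
   [1 + eta ^+ r + 1]. *)
rewrite sumEFin lee_fin -mulr_suml -(bigA_distr_bigA (fun j (b : 'I_3) => if (b == 1%N :> nat) then eta ^+ r else 1)) /=.
rewrite prodr_const card_ord !big_ord_recl big_ord0 /=.
rewrite /rho expr_div_n; apply: ler_wpM2r; first by rewrite invr_ge0 exprn_ge0 // ltW.
by rewrite lerXn2r ?nnegrE //; lra.
Qed.
End TernaryUpper.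

(** * Lower bounds by expanding maps *)

Section HolderLower.
Variable R : realType.

Lemma fine_diam_pow_le (s s' c : R) (U : set R) : 0 < s -> 0 <= s' <= s -> 0 <= c ->
  (diam U <= 1%:E)%E -> U !=set0 -> ((c * fine (diam U) `^ s)%:E <= c%:E * diam_pow s' U)%E.
Proof.
move=> s0 /andP[s'0 s's] c0 U1 /set0P U0.
have dU0 := diam_ge0 U.
have fU : diam U \is a fin_num.
  by rewrite ge0_fin_numE //; apply: le_lt_trans U1 _; rewrite ltry.
rewrite EFinM; apply: lee_wpmul2l; first by rewrite lee_fin.
rewrite /diam_pow (negbTE U0) -[in leRHS](fineK fU) poweR_EFin lee_fin.
have D1 : fine (diam U) <= 1 by rewrite -lee_fin fineK.
(* A singleton is treated apart: its diameter 0 has power 0 for the exponent [s > 0], whereas [s']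
   may be 0. *)
have := fine_ge0 dU0; rewrite le_eqVlt => /orP[/eqP <-|D0].
  by rewrite powR0 ?gt_eqF // powR_ge0.
by apply: ger_powR => //; rewrite D0.
Qed.

Lemma hausdorff_measure_holder (s s' c : R) (A : set R) (f : R -> R) :
  0 < s -> 0 <= s' <= s -> 0 < c ->
  (forall t, 0 <= t < 1 -> A (f t)) ->
  (forall t u, 0 <= t < 1 -> 0 <= u < 1 -> `|t - u| <= c * `|f t - f u| `^ s) ->
  hausdorff_measure s' A <> 0%E.
Proof.
move=> s0 s's c0 Af holder /hausdorff_measure0P /(_ 1 ltr01) H.
suff : ((2 * c)^-1%:E <= hausdorff_content s' 1 A)%E.
  by rewrite H lee_fin leNgt invr_gt0 mulr_gt0.
apply: le_ereal_inf_tmp => _ [C [AC dC] <-].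
pose D k := fine (diam (C k)).
pose P k := exists t : R, 0 <= t < 1 /\ C k (f t).
pose F k : set (measurableTypeR R) := if pselect (P k) is left h then
  `[sval (cid h) - c * D k `^ s, sval (cid h) + c * D k `^ s]%classic else set0.
have mF k : measurable (F k) by rewrite /F; case: pselect => h; [exact: measurable_itv|exact: measurable0].
have cD0 k : 0 <= c * D k `^ s by rewrite mulr_ge0 ?powR_ge0 // ltW.
have cover : `[0%R, 1%R[%classic `<=` \bigcup_k F k.
  move=> t /=; rewrite in_itv /= => t01.
  have [k _ Ct] := AC _ (Af t t01); exists k => //.
  rewrite /F; case: pselect => h; last by exfalso; apply: h; exists t.
  case: cid => u [u01 Cu] /=; rewrite in_itv /= -ler_distl.
  apply: le_trans (holder _ _ t01 u01) _; rewrite ler_pM2l //.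
  have fd : diam (C k) \is a fin_num.
    by rewrite ge0_fin_numE ?diam_ge0 //; apply: le_lt_trans (dC k) _; rewrite ltry.
  apply: ge0_ler_powR; rewrite ?nnegrE ?(ltW s0) ?fine_ge0 ?diam_ge0 //.
  by rewrite -lee_fin fineK // diam_ge.
have leF k : (lebesgue_measure (F k) <= (2 * c)%:E * diam_pow s' (C k))%E.
  have c20 : 0 <= 2 * c by rewrite mulr_ge0 // ltW.
  rewrite /F; case: pselect => h; last by rewrite measure0 mule_ge0 ?lee_fin ?diam_pow_ge0.
  apply: le_trans (fine_diam_pow_le s0 s's c20 (dC k) _); last first.
    by case: h => t [_ Ct]; exists (f t).
  rewrite lebesgue_measure_itv /=; case: ifP => _; last first.
    by rewrite lee_fin mulr_ge0 ?powR_ge0.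
  by rewrite -EFinB lee_fin /D; lra.
have : (lebesgue_measure (`[0%R, 1%R[%classic : set (measurableTypeR R)) <=
    \sum_(0 <= k <oo) lebesgue_measure (F k))%E.
  by apply: measure_sigma_subadditive => //; exact: measurable_itv.
rewrite lebesgue_measure_itv /= lte_fin ltr01 oppr0 adde0 => h.
have {h} := le_trans h (lee_nneseries (fun k _ _ => measure_ge0 _ _) (fun k _ => leF k)).
rewrite nneseriesZl; last by move=> k _; exact: diam_pow_ge0.
by rewrite muleC -lee_pdivrMr ?mulr_gt0 // mul1e.
Qed.

End HolderLower.

(** * Well-separated fractions *)

Section CoprimeCount.

Lemma sum_sqr_divn_le (Q n : nat) :
  (4 * \sum_(2 <= d < n.+1) (Q %/ d) ^ 2 <= 3 * Q ^ 2)%N.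
Proof.
(* Telescoping: 1/(n+1)^2 <= 1/n - 1/(n+1). *)
have tail : 4 * \sum_(2 <= d < n.+1) (d%:R ^- 2 : rat) <= 3.
  case: n => [|[|n]]; [by rewrite big_geq|by rewrite big_geq|].
  suff : 4 * \sum_(2 <= d < n.+3) (d%:R ^- 2 : rat) <= 3 - 4 * n.+2%:R^-1.
    by move=> h; apply: le_trans h _; rewrite lerBlDr lerDl mulr_ge0 ?invr_ge0 ?ler0n.
  elim: n => [|n IH]; first by rewrite big_ltn ?big_geq; [lra| |].
  rewrite big_nat_recr //= mulrDr; apply: le_trans (lerD IH (lexx _)) _.
  have n0 : 0 < n.+2%:R :> rat by rewrite ltr0n.
  have -> : n.+3%:R = n.+2%:R + 1 :> rat by rewrite natr1.
  move: (n.+2%:R : rat) n0 => x x0.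
  have : x^-1 - (x + 1)^-1 - (x + 1) ^- 2 = (x * (x + 1) ^+ 2)^-1.
    by field; rewrite !gt_eqF // addr_gt0.
  have : 0 < (x * (x + 1) ^+ 2)^-1 by rewrite invr_gt0 mulr_gt0 // exprn_gt0 // addr_gt0.
  lra.
rewrite -(ler_nat rat) [leLHS]natrM [leRHS]natrM natr_sum natrX.
apply: (@le_trans _ _ (4 * \sum_(2 <= d < n.+1) (Q%:R ^+ 2 * d%:R ^- 2))).
  rewrite ler_pM2l // !big_nat; apply: ler_sum => d /andP[d2 _].
  have d0 : 0 < d%:R :> rat by rewrite ltr0n; apply: leq_trans d2.
  rewrite ler_pdivlMr ?exprn_gt0 // natrX -exprMn lerXn2r ?nnegrE // ?mulr_ge0 //.
  by rewrite -natrM ler_nat leq_divM.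
by rewrite -mulr_sumr mulrCA mulrC ler_wpM2r ?exprn_ge0.
Qed.

(** A pair that is not coprime has a common divisor [d >= 2], for instance its gcd, and
    [(Q %/ d) ^ 2] pairs are divisible by a given [d]. By the union bound at most three quarters of
    the pairs are lost. *)
Lemma coprime_pairs_count (Q : nat) :
  (Q ^ 2 <= 4 * \sum_(1 <= p < Q.+1) \sum_(1 <= q < Q.+1) coprime p q)%N.
Proof.
set S := (\sum_(1 <= p < Q.+1) _)%N.
suff H : (Q ^ 2 <= S + \sum_(2 <= d < Q.+1) (Q %/ d) ^ 2)%N.
  have := sum_sqr_divn_le Q Q; lia.
have -> : (\sum_(2 <= d < Q.+1) (Q %/ d) ^ 2 =
    \sum_(1 <= p < Q.+1) \sum_(1 <= q < Q.+1) \sum_(2 <= d < Q.+1) (d %| p) * (d %| q))%N.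
  under [RHS]eq_bigr do rewrite exchange_big.
  rewrite exchange_big /=; apply: eq_bigr => d _.
  under eq_bigr do rewrite -big_distrr.
  by rewrite -big_distrl /= -divn_count_dvd.
rewrite /S -big_split /=; under eq_bigr do rewrite -big_split /=.
apply: (@leq_trans (\sum_(1 <= p < Q.+1) \sum_(1 <= q < Q.+1) 1)%N).
  by rewrite !sum_nat_const_nat subn1 /= muln1.
rewrite !big_nat; apply: leq_sum => p /andP[p1 pQ].
rewrite !big_nat; apply: leq_sum => q /andP[q1 qQ].
case: (boolP (coprime p q)) => // ncop; rewrite add0n.
have g0 : (0 < gcdn p q)%N by rewrite gcdn_gt0 p1.
have g2 : (1 < gcdn p q)%N by move: ncop; rewrite /coprime; lia.
have gQ : gcdn p q \in index_iota 2 Q.+1.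
  by rewrite mem_index_iota g2; have := dvdn_leq p1 (dvdn_gcdl p q); lia.
rewrite (bigD1_seq (gcdn p q) gQ) ?iota_uniq //=.
by rewrite dvdn_gcdl dvdn_gcdr.
Qed.

End CoprimeCount.

Section SeparatedFractions.
Variable R : realType.

Definition coprime_pairs (Q : nat) : seq (nat * nat) :=
  [seq pq <- [seq (p, q) | p <- index_iota 1 Q.+1, q <- index_iota 1 Q.+1]
  | coprime pq.1 pq.2].

Lemma mem_coprime_pairs Q p q : (p, q) \in coprime_pairs Q =
  [&& coprime p q, 0 < p <= Q & 0 < q <= Q]%N.
Proof.
rewrite mem_filter /=; congr (_ && _).
apply/allpairsP/idP => [[[a b] /= [aQ bQ [-> ->]]]|/andP[pQ qQ]].
  by move: aQ bQ; rewrite !mem_index_iota !ltnS => -> ->.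
by exists (p, q); split => //=; rewrite mem_index_iota ltnS.
Qed.

Lemma size_coprime_pairs Q : (Q ^ 2 <= 4 * size (coprime_pairs Q))%N.
Proof.
rewrite size_filter -sum1_count big_mkcond big_allpairs /=.
exact: coprime_pairs_count.
Qed.

(* With denominator [p + q] rather than [q], all coprime pairs give fractions in
   [0, 1[, so no ordering of [p] and [q] has to be imposed. *)
Definition mediant_frac (pq : nat * nat) : R := pq.1%:R / (pq.1 + pq.2)%:R.

Lemma sub_frac_ge (p q p' q' : nat) : (0 < q)%N -> (0 < q')%N ->
  p%:R / q%:R < p'%:R / q'%:R :> R ->
  (q * q')%:R^-1 <= p'%:R / q'%:R - p%:R / q%:R :> R.
Proof.
move=> q0 q'0; have Q0 : 0 < q%:R :> R by rewrite ltr0n.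
have Q'0 : 0 < q'%:R :> R by rewrite ltr0n.
rewrite ltr_pdivlMr // mulrAC ltr_pdivrMr // -!natrM ltr_nat => h.
have -> : p'%:R / q'%:R - p%:R / q%:R = ((p' * q)%:R - (p * q')%:R) / (q * q')%:R :> R.
  by rewrite !natrM; field; rewrite !gt_eqF.
rewrite -[leLHS]mul1r ler_wpM2r ?invr_ge0 // lerBrDr.
by rewrite nat1r ler_nat.
Qed.

(** Cross-multiplication cancels [p * p'] and leaves [p * q' = p' * q], an equality of two reduced
    fractions. *)
Lemma mediant_frac_inj (Q : nat) : {in coprime_pairs Q &, injective mediant_frac}.
Proof.
move=> [p q] [p' q']; rewrite !mem_coprime_pairs /mediant_frac /=.
move=> /and3P[c1 /andP[p0 _] /andP[q0 _]] /and3P[c2 /andP[p'0 _] /andP[q'0 _]].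
move=> /eqP; rewrite eqr_div ?pnatr_eq0 -?lt0n ?addn_gt0 ?p0 ?p'0 //.
rewrite -!natrM eqr_nat !mulnDr [(p' * p)%N]mulnC eqn_add2l => /eqP e.
have pp' : p = p'.
  apply/eqP; rewrite eqn_dvd; apply/andP; split.
    by rewrite -(Gauss_dvdl _ c1) -e dvdn_mulr.
  by rewrite -(Gauss_dvdl _ c2) e dvdn_mulr.
by move: e; rewrite pp' => /eqP; rewrite eqn_pmul2l // => /eqP ->.
Qed.

(** Once the fractions are sorted, neighbours differ by at least the inverse product of their
    denominators, both at most [2 * Q], and these gaps add up. *)
Lemma separated_fractions (Q : nat) : exists s : seq R,
  [/\ (Q ^ 2 <= 4 * size s)%N,
      forall i, (i < size s)%N ->
        exists p q, [/\ (p < q)%N, (q <= 2 * Q)%N & s`_i = p%:R / q%:R]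
    & forall i j, (i < j)%N -> (j < size s)%N ->
        (j - i)%:R / (2 * Q)%:R ^+ 2 <= s`_j - s`_i].
Proof.
pose s := sort <=%R [seq mediant_frac pq | pq <- coprime_pairs Q].
have szs : size s = size (coprime_pairs Q) by rewrite size_sort size_map.
have mems i : (i < size s)%N -> exists p q, [/\ (p < q)%N, (q <= 2 * Q)%N & s`_i = p%:R / q%:R].
  move=> /(mem_nth 0); rewrite mem_sort => /mapP[[p q]].
  rewrite mem_coprime_pairs => /and3P[_ /andP[p0 pQ] /andP[q0 qQ]] ->.
  by exists p, (p + q)%N; split => //; lia.
have us : uniq s.
  rewrite sort_uniq map_inj_in_uniq; last exact: mediant_frac_inj.
  by rewrite filter_uniq // allpairs_uniq ?iota_uniq // => -[a b] [c d] _ _ /= [-> ->].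
have lts : sorted <%R s by rewrite lt_sorted_uniq_le us sort_sorted //; exact: le_total.
exists s; split => //; first by rewrite szs size_coprime_pairs.
have step i : (i.+1 < size s)%N -> (2 * Q)%:R ^- 2 <= s`_i.+1 - s`_i.
  move=> iS; have lt1 : s`_i < s`_i.+1.
    by rewrite (sorted_ltn_nth lt_trans) ?inE // (ltnW iS).
  have [p [q [pq qQ ei]]] := mems i (ltnW iS).
  have [p' [q' [pq' qQ' ei']]] := mems i.+1 iS.
  rewrite ei ei' in lt1 *.
  have q0 : (0 < q)%N by apply: leq_ltn_trans pq.
  have q'0 : (0 < q')%N by apply: leq_ltn_trans pq'.
  apply: le_trans (sub_frac_ge q0 q'0 lt1).
  rewrite lef_pV2 ?posrE ?exprn_gt0 ?ltr0n ?muln_gt0 ?q0 ?q'0 //; last by lia.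
  by rewrite -natrX ler_nat -mulnn leq_mul.
move=> i j; elim: j => // j IH; rewrite ltnS leq_eqVlt => /orP[/eqP -> jS|ij jS].
  by rewrite subSnn div1r step.
have := IH ij (ltnW jS); have := step j jS.
rewrite subSn ?(ltnW ij) // -natr1 mulrDl div1r; lra.
Qed.

End SeparatedFractions.

(* Inside a ternary cylinder, [e d] is the address, [D] levels further down, of
   the [d]-th of [N] subcylinders.  The last condition says, without truncated
   subtraction, that points of the [d]-th and [d']-th are at distance at least
   [(d' - d) / (32 N)] times the length of the parent; 32 is what a rational
   step with [4 N >= Q^2] fractions of gap [1 / (2Q)^2] allows. *)
Definition separated_children (N D : nat) (e : nat -> nat) : Prop :=
  [/\ (2 <= N)%N, (0 < D)%N, forall d, (d < N)%N -> (e d < 3 ^ D)%N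
    & forall d d', (d < d')%N -> (d' < N)%N ->
        ((d' - d) * 3 ^ D + 32 * N * (e d).+1 <= 32 * N * e d')%N].

Lemma separated_children_digit : separated_children 2 1 (fun d => 2 * d)%N.
Proof.
by split => //; [case=> [|[|]]|case=> [|[|d]] [|[|d']]].
Qed.

(** * Subcylinders close to rational points *)

Section RationalStep.
Variable R : realType.

Lemma powR_inv (x a : R) : 0 <= x -> x^-1 `^ a = (x `^ a)^-1.
Proof. by move=> x0; rewrite -!powR_inv1 ?powR_ge0 // powRAC. Qed.

Lemma exists_pow3 (x : R) : 1 <= x -> exists l : nat, x <= 3 ^+ l <= 3 * x.
Proof.
move=> x1.
have ex : exists l, x <= 3 ^+ l.
  exists (Num.truncn x).+1; apply: le_trans (ltW (truncnS_gt x)) _.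
  by rewrite -natrX ler_nat; exact/ltnW/ltn_expl.
case: (ex_minnP ex) => -[|l] xl min.
  by exists 0%N; rewrite xl expr0; lra.
exists l.+1; rewrite xl exprS ler_pM2l //; apply: ltW; rewrite ltNge; apply/negP => /min.
by rewrite ltnn.
Qed.

(** As [c < 2], it suffices that [Q] to the power [2 - c] exceeds [48 * b ^+ 2]. In a rational step
    48 splits into 12, from [3 ^+ l <= 12 * X], and 4, from [Q ^ 2 <= 4 * N]. *)
Lemma exists_large_denominator (b c : R) : 1 <= b -> 0 < c -> c < 2 ->
  exists Q : nat, (0 < Q)%N /\ 48 * (b * Q%:R) `^ c <= Q%:R ^+ 2.
Proof.
move=> b1 c0 c2; have b0 : 0 < b by apply: lt_le_trans b1.
pose M : R := 48 * b ^+ 2.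
have b2 : 1 <= b ^+ 2 by rewrite exprn_ege1.
have M1 : 1 <= M by rewrite /M; lra.
have M0 : 0 < M by apply: lt_le_trans M1.
pose Q := (Num.truncn (M `^ (2 - c)^-1)).+1.
have Q1 : 1 <= Q%:R :> R by rewrite ler1n.
have Q0 : 0 < Q%:R :> R by apply: lt_le_trans Q1.
exists Q; split => //.
have MQ : M <= Q%:R `^ (2 - c).
  have {1}-> : M = (M `^ (2 - c)^-1) `^ (2 - c).
    by rewrite -powRrM mulVf ?gt_eqF ?subr_gt0 // powRr1 // ltW.
  apply: ge0_ler_powR; rewrite ?nnegrE ?powR_ge0 ?subr_ge0 ?(ltW c2) //.
  exact/ltW/truncnS_gt.
have -> : Q%:R ^+ 2 = Q%:R `^ c * Q%:R `^ (2 - c).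
  rewrite -powRD; first by rewrite addrC subrK powR_mulrn.
  by rewrite (gt_eqF Q0) implybT.
rewrite powRM ?(ltW b0) ?(ltW Q0) // mulrA mulrC ler_wpM2l ?powR_ge0 //.
apply: le_trans MQ; rewrite /M ler_pM2l // -powR_mulrn ?(ltW b0) //.
by apply: ler_powR => //; exact: ltW.
Qed.

Lemma rational_step (delta s : R) (m : nat) : 1 <= delta -> 0 < s -> s * delta < 1 ->
  exists N D e, [/\ separated_children N D e,
    (3 ^+ (m + D)) `^ s <= N%:R &
    forall a d (x : R), (a < 3 ^ m)%N -> (d < N)%N ->
      (a * 3 ^ D + e d)%:R <= x * 3 ^+ (m + D) <= (a * 3 ^ D + e d).+1%:R ->
      exists pq, [/\ rat_index pq,
        cball (Defs.contract delta (rat_ball R pq)) x &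
        `|x - pq.1%:R / pq.2%:R| <= 3 ^- (m + D)]].
Proof.
move=> d1 s0 sd; have d0 : 0 < delta by apply: lt_le_trans d1.
have s1 : s < 1.
  by apply: le_lt_trans sd; rewrite ler_peMr // ltW.
have m1 : 1 <= 3 ^+ m :> R by rewrite exprn_ege1 // ler1n.
have b1 : 1 <= 2 * 3 ^+ m :> R by lra.
have c0 : 0 < 2 * (s * delta) by rewrite !mulr_gt0.
have c2 : 2 * (s * delta) < 2 by lra.
have [Q [Q0 HQ]] := exists_large_denominator b1 c0 c2.
have Q1 : 1 <= Q%:R :> R by rewrite ler1n.
pose b : R := 2 * 3 ^+ m * Q%:R.
have b1' : 1 <= b by rewrite /b; apply: mulr_ege1.
have b0 : 0 < b by apply: lt_le_trans b1'.
pose X := b `^ (2 * delta).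
have X1 : b ^+ 2 <= X.
  by rewrite -powR_mulrn ?(ltW b0) //; apply: ler_powR => //; rewrite ler_peMr.
have X11 : 1 <= X by apply: le_trans X1; rewrite exprn_ege1.
have [l /andP[l1 l2]] : exists l : nat, 4 * X <= 3 ^+ l <= 3 * (4 * X).
  by apply: exists_pow3; lra.
have [f [sizef memf sepf]] := separated_fractions R Q.
pose N := size f.
have bQ : 4 * Q%:R ^+ 2 * (3 ^+ m) ^+ 2 = b ^+ 2 by rewrite /b; ring.
have Q21 : 1 <= Q%:R ^+ 2 :> R by rewrite exprn_ege1.
have ml : (m <= l)%N.
  rewrite -(@ler_eXn2l R 3) ?ltr1n //; nra.
pose D := (l - m)%N.
have mD : (m + D = l)%N by rewrite subnKC.
have lD : 3 ^+ l = 3 ^+ m * 3 ^+ D :> R by rewrite -mD exprD.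
(* Consecutive fractions are thus at least 4 subcylinder lengths apart, which absorbs the
   truncations in [e]. *)
have D16 : 16 * Q%:R ^+ 2 <= 3 ^+ D :> R.
  have : 3 ^+ m * (16 * Q%:R ^+ 2) <= 3 ^+ m * 3 ^+ D :> R by nra.
  by rewrite ler_pM2l // exprn_gt0.
have D0 : (0 < D)%N.
  by rewrite lt0n; apply/negP => /eqP D0; move: D16; rewrite D0 expr0; lra.
have NX : 12 * X `^ s <= N%:R.
  have -> : X `^ s = b `^ (2 * (s * delta)).
    by rewrite /X -powRrM; congr (_ `^ _); ring.
  have : (Q ^ 2)%:R <= (4 * N)%:R :> R by rewrite ler_nat.
  rewrite natrM natrX -/b in HQ *; move: HQ; rewrite -/b; lra.
have Xs1 : 1 <= X `^ s.
  have : 1 `^ s <= X `^ s by apply: ge0_ler_powR; rewrite ?nnegrE ?(ltW s0) //; lra.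
  by rewrite powR1.
pose e d := Num.truncn (f`_d * 3 ^+ D).
have fge0 d : (d < N)%N -> 0 <= f`_d.
  by move=> /memf [p [q [_ _ ->]]]; rewrite divr_ge0.
have e_itv d : (d < N)%N -> (e d)%:R <= f`_d * 3 ^+ D < (e d).+1%:R.
  by move=> dN; apply: truncn_itv; rewrite mulr_ge0 ?fge0 // exprn_ge0.
exists N, D, e; split.
- split => //.
  + by rewrite -(ler_nat R); lra.
  + move=> d dN; rewrite -(ltr_nat R) natrX.
    have /andP[h _] := e_itv d dN; apply: le_lt_trans h _.
    rewrite gtr_pMl ?exprn_gt0 //; have [p [q [pq _ ->]]] := memf d dN.
    by rewrite ltr_pdivrMr ?ltr0n ?mul1r ?ltr_nat //; apply: leq_ltn_trans pq.
  + move=> d d' dd' d'N.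
    have dN : (d < N)%N by apply: ltn_trans d'N.
    have /andP[h1 _] := e_itv d dN; have /andP[_ h2] := e_itv d' d'N.
    rewrite -[(e d').+1%:R]natr1 in h2.
    have sep := sepf d d' dd' d'N; rewrite natrM in sep.
    have k1 : 1 <= (d' - d)%:R :> R by rewrite ler1n subn_gt0.
    rewrite -(ler_nat R) natrD !natrM natrX -[(e d).+1%:R]natr1.
    move: (d' - d)%N k1 sep => k k1 sep.
    have Q4 : Q%:R ^+ 2 <= 4 * N%:R :> R by rewrite -natrX -natrM ler_nat.
    (* [g] is half of the guaranteed gap in subcylinder lengths. Truncation and the width of one
       subcylinder cost at most 2, hence at most [g]; then [Q ^ 2 <= 4 * N] turns 8 into 32. *)
    set g := k%:R * 3 ^+ D / (8 * Q%:R ^+ 2) : R.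
    have Q20 : 0 < 8 * Q%:R ^+ 2 :> R by lra.
    have gE : g * (8 * Q%:R ^+ 2) = k%:R * 3 ^+ D by rewrite /g divfK ?gt_eqF.
    have g2 : 2 <= g by rewrite /g ler_pdivlMr //; nra.
    have : 2 * g <= (f`_d' - f`_d) * 3 ^+ D.
      apply: le_trans (_ : k%:R / (2 * Q%:R) ^+ 2 * 3 ^+ D <= _).
        rewrite /g le_eqVlt; apply/orP; left; apply/eqP; field.
        by rewrite gt_eqF //; lra.
      by rewrite ler_pM2r ?exprn_gt0.
    rewrite mulrBl => g3.
    have g4 : g <= (e d')%:R - (e d)%:R - 1 by lra.
    have N0 : 0 <= N%:R :> R by [].
    nra.
- rewrite mD.
  apply: (@le_trans _ _ ((12 * X) `^ s)).
    by apply: ge0_ler_powR; rewrite ?nnegrE ?exprn_ge0 ?mulr_ge0 ?(ltW s0) //; lra.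
  rewrite powRM //; last by lra.
  apply: le_trans NX; rewrite ler_wpM2r ?powR_ge0 //.
  by apply: ler1_powR; rewrite ?ler1n // ltW.
- move=> a d x a3 dN; rewrite mD => /andP[x1 x2].
  have [p [q [pq qQ fd]]] := memf d dN.
  have q0 : (0 < q)%N by apply: leq_ltn_trans pq.
  have Rq0 : 0 < q%:R :> R by rewrite ltr0n.
  have /andP[h1 h2] := e_itv d dN.
  (* This is [(a + p / q) / 3 ^ m], the fraction carried into the cylinder of address [a]; it need
     not be reduced. *)
  exists (a * q + p, 3 ^ m * q)%N; rewrite /=.
  have dist : `|x - (a * q + p)%:R / (3 ^ m * q)%:R| <= 3 ^- l.
    have yE : (a * q + p)%:R / (3 ^ m * q)%:R * 3 ^+ l = (a * 3 ^ D)%:R + f`_d * 3 ^+ D :> R.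
      rewrite fd lD !(natrD, natrM, natrX); field.
      by rewrite gt_eqF //= expf_neq0.
    have l0 : 0 < 3 ^+ l :> R by rewrite exprn_gt0.
    rewrite -[leRHS]mul1r ler_pdivlMr // -[X in _ * X](gtr0_norm l0) -normrM mulrBl yE.
    rewrite -[(e d).+1%:R]natr1 in h2.
    rewrite -[(_ + _).+1%:R]natr1 natrD in x2; rewrite natrD in x1.
    by rewrite ler_norml; apply/andP; split; lra.
  split => //.
  + split => /=; first by rewrite muln_gt0 expn_gt0 q0.
    apply: (@leq_trans (a.+1 * q)%N); last by rewrite leq_mul2r a3 orbT.
    by rewrite mulSn addnC leq_add2r ltnW.
  + rewrite /cball /= in_itv /= -ler_distl; apply: le_trans dist _.
    apply: (@le_trans _ _ X^-1).
      by rewrite lef_pV2 ?posrE ?exprn_gt0 //; lra.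
    rewrite powR_inv ?exprn_ge0 // lef_pV2 ?posrE ?powR_gt0 ?exprn_gt0 ?ltr0n ?muln_gt0 ?expn_gt0 ?q0 //.
    rewrite /X powRrM powR_mulrn ?(ltW b0) //.
    apply: ge0_ler_powR; rewrite ?nnegrE ?exprn_ge0 ?(ltW d0) ?(ltW b0) //.
    rewrite lerXn2r ?nnegrE ?(ltW b0) // /b natrM natrX.
    have : q%:R <= 2 * Q%:R :> R by rewrite -natrM ler_nat.
    nra.
Qed.
End RationalStep.

(** * Nested ternary cylinders *)

Section NestedCylinders.
Variable R : realType.
Variables (N D l : nat -> nat) (e : nat -> nat -> nat).
Hypothesis l0 : l 0 = 0%N.
Hypothesis lS : forall n, l n.+1 = (l n + D n)%N.
Hypothesis sep : forall n, separated_children (N n) (D n) (e n).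
Implicit Types (t u : R).

Definition radix n : nat := \prod_(i < n) N i.

Definition radix_trunc t n : nat := Num.truncn (t * (radix n)%:R).

Definition radix_digit t n : nat := radix_trunc t n.+1 %% N n.

Fixpoint address t n : nat :=
  if n is m.+1 then (address t m * 3 ^ D m + e m (radix_digit t m))%N else 0%N.

(** The first [k] ternary digits, read as an integer. Stage [k] determines them because [k <= l k];
    [ternary_prefixE] shows that any sufficiently late stage gives the same value. *)
Definition ternary_prefix t k : nat := address t k %/ 3 ^ (l k - k).

Definition address_word t : word :=
  fun k => Ordinal (ltn_pmod (ternary_prefix t k.+1) (isT : 0 < 3)%N).

Let N2 n : (2 <= N n)%N. Proof. by case: (sep n). Qed.
Let N0 n : (0 < N n)%N. Proof. exact: ltnW (N2 n). Qed.
Let e_lt n d : (d < N n)%N -> (e n d < 3 ^ D n)%N.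
Proof. by case: (sep n) => _ _ + _; apply. Qed.

Lemma radix_digit_lt t n : (radix_digit t n < N n)%N.
Proof. by rewrite ltn_pmod. Qed.

Lemma leq_level_id n : (n <= l n)%N.
Proof.
elim: n => [|n IH]; first by rewrite l0.
by rewrite lS; have [_ D0 _ _] := sep n; lia.
Qed.

Lemma level_mono m n : (m <= n)%N -> (l m <= l n)%N.
Proof.
elim: n => [|n IH]; first by rewrite leqn0 => /eqP ->.
by rewrite leq_eqVlt => /orP[/eqP -> //|/IH h]; rewrite lS (leq_trans h) // leq_addr.
Qed.

(** The cylinders are nested: since [e n d < 3 ^ D n], a stage only appends [D n] ternary digits,
    and division removes them again. *)
Lemma address_div t m n : (m <= n)%N ->
  (address t n %/ 3 ^ (l n - l m))%N = address t m.
Proof.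
elim: n => [|n IH]; first by rewrite leqn0 => /eqP ->; rewrite subnn divn1.
rewrite leq_eqVlt => /orP[/eqP -> |]; first by rewrite subnn divn1.
rewrite ltnS => mn; rewrite -(IH mn) lS.
rewrite (_ : l n + D n - l m = D n + (l n - l m))%N; last first.
  by have := level_mono mn; lia.
have es := e_lt (radix_digit_lt t n).
by rewrite expnD divnMA /= divnMDl ?expn_gt0 // (divn_small es) addn0.
Qed.

Lemma ternary_prefixE t k n : (k <= l n)%N ->
  ternary_prefix t k = (address t n %/ 3 ^ (l n - k))%N.
Proof.
move=> kn; rewrite /ternary_prefix.
have kk := leq_level_id k.
case: (leqP k n) => h.
  rewrite -(address_div t h) -divnMA -expnD; congr (_ %/ 3 ^ _)%N.
  by have := level_mono h; lia.
rewrite -(address_div t (ltnW h)) -divnMA -expnD; congr (_ %/ 3 ^ _)%N.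
by have := level_mono (ltnW h); lia.
Qed.

Lemma ternary_prefix_level t n : ternary_prefix t (l n) = address t n.
Proof. by rewrite (@ternary_prefixE t (l n) n) // subnn divn1. Qed.

Lemma ternary_prefixS t k :
  ternary_prefix t k.+1 = (3 * ternary_prefix t k + address_word t k)%N.
Proof.
rewrite /= [LHS](divn_eq _ 3) mulnC; congr (3 * _ + _)%N.
have kl := leq_level_id k.+1.
rewrite (@ternary_prefixE t k k.+1 (ltnW kl)) /ternary_prefix -divnMA -expnSr.
by congr (_ %/ 3 ^ _)%N; lia.
Qed.

Lemma ifs_comp_address_word t k :
  ifs_comp k (address_word t) 0 = (ternary_prefix t k)%:R / 3 ^+ k :> R.
Proof.
elim: k => [|k IH]; first by rewrite /= /ternary_prefix /= div0n mul0r.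
have -> : ifs_comp k.+1 (address_word t) 0 =
    ifs_comp k (address_word t) 0 + (address_word t k : nat)%:R / 3 ^+ k.+1 :> R.
  by rewrite !ifs_compE !mul0r !addr0 big_ord_recr.
rewrite IH ternary_prefixS natrD natrM exprS; field.
by rewrite expf_neq0.
Qed.

Lemma address_bounds t n :
  (address t n)%:R <= coding R (address_word t) * 3 ^+ l n <= (address t n).+1%:R.
Proof.
have := coding_bounds R (l n) (address_word t).
rewrite ifs_comp_address_word ternary_prefix_level -[X in _ + X]div1r -mulrDl natr1.
by rewrite ler_pdivrMr ?ler_pdivlMr ?exprn_gt0.
Qed.

Lemma address_lt t n : (address t n < 3 ^ l n)%N.
Proof.
elim: n => [|n IH]; first by rewrite l0.
rewrite lS expnD /=; have := e_lt (radix_digit_lt t n); nia.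
Qed.

Lemma radix_truncS t n : 0 <= t ->
  radix_trunc t n.+1 = (radix_trunc t n * N n + radix_digit t n)%N.
Proof.
move=> t0; rewrite [LHS](divn_eq _ (N n)); congr (_ * _ + _)%N.
rewrite /radix_trunc /radix big_ord_recr /= natrM mulrA.
set x := t * _; have x0 : 0 <= x by rewrite mulr_ge0.
have N0' : 0 < (N n)%:R :> R by rewrite ltr0n.
apply/eqP; rewrite eqn_leq; apply/andP; split.
  rewrite truncn_ge_nat // -(@ler_pM2r _ (N n)%:R) // -natrM.
  apply: le_trans (_ : (Num.truncn (x * (N n)%:R))%:R <= _).
    by rewrite ler_nat leq_divM.
  by rewrite truncn_le mulr_ge0.
rewrite leq_divRL // truncn_ge_nat ?mulr_ge0 // natrM ler_pM2r //.
by rewrite truncn_le.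
Qed.

Lemma eq_address t u n :
  (forall i, (i <= n)%N -> radix_trunc t i = radix_trunc u i) ->
  address t n = address u n.
Proof.
elim: n => //= n IH tu; rewrite IH => [|i /leqW /tu //].
by rewrite /radix_digit tu.
Qed.

Lemma radix_ge n : (2 ^ n <= radix n)%N.
Proof.
elim: n => [|n IH]; first by rewrite /radix big_ord0.
by rewrite /radix big_ord_recr /= expnSr leq_mul.
Qed.

Lemma radix_trunc_separates t u : t < u -> 0 <= t ->
  exists n, radix_trunc t n != radix_trunc u n.
Proof.
move=> tu t0.
pose n := (Num.truncn (u - t)^-1).+1.
have ut0 : 0 < u - t by rewrite subr_gt0.
have h : 1 <= (u - t) * (radix n)%:R.
  rewrite -ler_pdivrMl // mulr1; apply: le_trans (ltW (truncnS_gt _)) _.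
  by rewrite ler_nat; apply: leq_trans (radix_ge n); exact/ltnW/ltn_expl.
exists n; apply: contraTneq h => tu'; rewrite -ltNge.
have p0 : 0 <= (radix n)%:R :> R by [].
have /andP[a1 a2] := truncn_itv (mulr_ge0 t0 p0).
have /andP[b1 b2] := truncn_itv (mulr_ge0 (le_trans t0 (ltW tu)) p0).
move: a1 b2; rewrite -/(radix_trunc t n) tu' -/(radix_trunc u n) -natr1 mulrBl; lra.
Qed.

(** Up to the first stage where [t] and [u] separate they share a cylinder of level [l n]; there
    their digits differ by [k]. With [v = k / N n], the images are at least [v / (32 * 3 ^+ l n)]
    apart, while [t] and [u] are within [(k + 1) / radix n.+1 <= 2 * v / radix n]. *)
Lemma coding_address_word_holder (s : R) : 0 < s <= 1 ->
  (forall n, (3 ^+ l n) `^ s <= (radix n)%:R) ->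
  forall t u, 0 <= t < 1 -> 0 <= u < 1 ->
  `|t - u| <= 2 * 32 `^ s * `|coding R (address_word t) - coding R (address_word u)| `^ s.
Proof.
move=> /andP[s0 s1] Hrad t u.
wlog tu : t u / t < u.
  move=> H t01 u01; have [/H|/H H'|<-] := ltgtP t u; first exact.
    by rewrite distrC [X in _ <= _ * X `^ _]distrC; exact: H'.
  by rewrite subrr normr0 mulr_ge0 ?mulr_ge0 ?powR_ge0.
move=> /andP[t0 t1] /andP[u0 u1].
have := ex_minnP (radix_trunc_separates tu t0) => -[[|n] /eqP neq min].
  (* Separation cannot occur at stage 0, where both truncations vanish on [[0, 1[]. *)
  have tr0 x : 0 <= x -> x < 1 -> Num.truncn x = 0%N :> nat.
    by move=> x0 x1; apply: truncn_def; rewrite x0.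
  by exfalso; apply: neq; rewrite /radix_trunc /radix big_ord0 !mulr1 !tr0.
have same i : (i <= n)%N -> radix_trunc t i = radix_trunc u i.
  by move=> i_n; apply/eqP; apply: contraLR i_n => /min; rewrite -ltnNge.
have ad := eq_address same.
have tS := radix_truncS n t0; have uS := radix_truncS n u0.
rewrite (same n (leqnn n)) in tS.
have rad0 m : 0 < (radix m)%:R :> R by rewrite ltr0n; apply: leq_trans (radix_ge m); rewrite expn_gt0.
have dlt : (radix_digit t n < radix_digit u n)%N.
  have : (radix_trunc t n.+1 <= radix_trunc u n.+1)%N.
    by apply: le_truncn; rewrite ler_pM2r // ltW.
  by move: neq; rewrite tS uS; lia.
have [_ _ _ /(_ _ _ dlt (radix_digit_lt u n)) sepn] := sep n.
have /andP[_ ft] := address_bounds t n.+1.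
have /andP[fu _] := address_bounds u n.+1.
set ct := coding R _ in ft *; set cu := coding R _ in fu *.
set k := (radix_digit u n - radix_digit t n)%N in sepn.
have k0 : (0 < k)%N by rewrite subn_gt0.
have kN : (k <= N n)%N by have := radix_digit_lt u n; lia.
have NR0 : 0 < (N n)%:R :> R by rewrite ltr0n.
have L0 : 0 < 3 ^+ l n :> R by rewrite exprn_gt0.
have D0 : 0 < 3 ^+ D n :> R by rewrite exprn_gt0.
have k1 : 1 <= k%:R :> R by rewrite ler1n.
pose v : R := k%:R / (N n)%:R.
have v0 : 0 < v by rewrite divr_gt0 // ltr0n.
have v1 : v <= 1 by rewrite ler_pdivrMr // mul1r ler_nat.
have far : v / 3 ^+ l n <= 32 * `|ct - cu|.
  move: sepn; rewrite -(ler_nat R) natrD !natrM natrX -[(e n _).+1%:R]natr1 => sepn.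
  move: ft fu; rewrite /= ad lS exprD -[(_ + _).+1%:R]natr1 !natrD natrM natrX.
  set ed := (e n _)%:R in sepn *; set ed' := (e n _)%:R in sepn *.
  move: (address u n)%:R => a ft fu.
  have gap : k%:R * 3 ^+ D n <= 32 * (N n)%:R * ((cu - ct) * (3 ^+ l n * 3 ^+ D n)).
    have : 0 <= 32 * (N n)%:R * ((cu - ct) * (3 ^+ l n * 3 ^+ D n) - (ed' - ed - 1)).
      by rewrite mulr_ge0 // ?mulr_ge0 //; lra.
    lra.
  have gap' : k%:R <= 32 * (N n)%:R * ((cu - ct) * 3 ^+ l n).
    by rewrite -(ler_pM2r D0); apply: le_trans gap _; rewrite le_eqVlt; apply/orP; left; apply/eqP; ring.
  rewrite /v ler_pdivrMr // ler_pdivrMr //; apply: le_trans gap' _.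
  rewrite [leRHS](_ : _ = 32 * (N n)%:R * (`|ct - cu| * 3 ^+ l n)); last by ring.
  rewrite ler_pM2l ?mulr_gt0 // ler_pM2r // distrC ler_norm //.
have near_tu : `|t - u| <= 2 * v / (radix n)%:R.
  rewrite distrC gtr0_norm ?subr_gt0 // ler_pdivlMr // /v mulrA ler_pdivlMr //.
  have /andP[a1 _] := truncn_itv (mulr_ge0 t0 (ltW (rad0 n.+1))).
  have /andP[_ b2] := truncn_itv (mulr_ge0 u0 (ltW (rad0 n.+1))).
  move: a1 b2; rewrite -/(radix_trunc t n.+1) -/(radix_trunc u n.+1) tS uS.
  have -> : (radix n.+1)%:R = (radix n)%:R * (N n)%:R :> R.
    by rewrite /radix big_ord_recr natrM.
  rewrite -[(_ + _).+1%:R]natr1 !natrD.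
  have kE : k%:R = (radix_digit u n)%:R - (radix_digit t n)%:R :> R by rewrite natrB // ltnW.
  move: k1; rewrite kE; lra.
(* v <= v^s since 0 < v <= 1: this is why separation relative to the parent
   cylinder suffices, whatever the number N n of children. *)
clearbody v; apply: le_trans near_tu _; rewrite -!mulrA ler_pM2l // -powRM //.
apply: le_trans (_ : (v / 3 ^+ l n) `^ s <= _); last first.
  by apply: ge0_ler_powR; rewrite ?nnegrE ?mulr_ge0 ?invr_ge0 ?(ltW s0) ?(ltW v0) ?(ltW L0).
rewrite powRM ?invr_ge0 ?(ltW v0) ?(ltW L0) // powR_inv ?(ltW L0) //.
apply: ler_pM; rewrite ?invr_ge0 ?(ltW v0) ?ger1_powR ?v0 ?v1 //.
by rewrite lef_pV2 ?posrE ?powR_gt0.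
Qed.
End NestedCylinders.

(** * The Cantor construction *)

Section LowerBound.
Variable R : realType.

Lemma limsup_rat_balls_approx (delta x : R) :
  (forall eps, 0 < eps -> exists pq, [/\ rat_index pq,
     cball (Defs.contract delta (rat_ball R pq)) x &
     `|x - pq.1%:R / pq.2%:R| <= eps]) ->
  limsup_rat_balls delta x.
Proof.
move=> H; rewrite /limsup_rat_balls /limsup_fam /=; set S := [set i | _] => Sfin.
(* If x is itself one of the fractions p/q, its multiples (k p, k q) already
   provide infinitely many balls; otherwise finitely many fractions stay at
   positive distance from x. *)
have [[[p q] [[q0 pq] _] /= xpq]|Sne] :=
    pselect (exists2 pq : nat * nat, S pq & x = pq.1%:R / pq.2%:R).
  rewrite /= in q0 pq.
  have : finite_set ((fun k => (k.+1 * p, k.+1 * q)%N) @` [set: nat]).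
    apply: sub_finite_set Sfin => _ [k _ <-]; split; first by split => /=; nia.
    have -> : x = (k.+1 * p)%:R / (k.+1 * q)%:R.
      by rewrite xpq !natrM -mulf_div divff ?mul1r // pnatr_eq0.
    by rewrite /cball /= in_itv /= lerBlDr lerDl powR_ge0.
  rewrite (eq_finite_set (inj_card_eq _)); first exact: infinite_nat.
  by move=> i j _ _ [_ /eqP]; rewrite eqn_pmul2r // => /eqP [].
have /finite_seqP[r Sr] := Sfin.
have [eps eps0 Heps] : exists2 eps : R, 0 < eps &
    forall pq, pq \in r -> eps < `|x - pq.1%:R / pq.2%:R|.
  have : forall pq, pq \in r -> 0 < `|x - pq.1%:R / pq.2%:R|.
    move=> pq rpq; rewrite normr_gt0 subr_eq0; apply/eqP => xe; apply: Sne.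
    by exists pq => //; rewrite Sr.
  elim: (r) => [|pq r' IH] pos; first by exists 1.
  have [|eps eps0 Heps] := IH; first by move=> pq' h; apply: pos; rewrite inE h orbT.
  have pos0 := pos pq (mem_head _ _).
  exists (Num.min eps (`|x - pq.1%:R / pq.2%:R| / 2)).
    by rewrite lt_min eps0 divr_gt0.
  move=> pq'; rewrite inE gt_min => /orP[/eqP ->|/Heps -> //].
  by rewrite ltr_pdivrMr // ltr_pMr // ltr1n orbT.
have [pq [idx bx xe]] := H eps eps0.
have : S pq by [].
by rewrite Sr /= => /Heps; rewrite ltNge xe.
Qed.

(** * Alternation of rational steps and digit steps *)

Section Machine.
Variable delta : R.
Variables (NQ DQ : nat -> nat) (eQ : nat -> nat -> nat).
Hypothesis sepQ : forall m, separated_children (NQ m) (DQ m) (eQ m).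

(* In state (l, c), l is the level of the cylinder reached and c the number of
   letters from {0, 2} still to be chosen before the next rational step.  The
   choice c = l ^ 2 after such a step makes the frequency of the letter 1 at
   the end of the run at most 1 / (1 + l). *)
Fixpoint schedule n : nat * nat :=
  if n is m.+1 then
    let: (l, c) := schedule m in
    if c is c'.+1 then (l.+1, c') else ((l + DQ l)%N, ((l + DQ l) ^ 2)%N)
  else (0%N, 0%N).

Definition sched_level n : nat := (schedule n).1.
Definition is_rational_step n : bool := (schedule n).2 == 0%N.
Definition sched_N n := if is_rational_step n then NQ (sched_level n) else 2%N.
Definition sched_D n := if is_rational_step n then DQ (sched_level n) else 1%N.
Definition sched_e n := if is_rational_step n then eQ (sched_level n) else fun d => (2 * d)%N.

Definition sched_word (t : R) : word :=
  address_word sched_N sched_D sched_level sched_e t.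

Lemma sched_levelS n : sched_level n.+1 = (sched_level n + sched_D n)%N.
Proof.
rewrite /sched_level /sched_D /is_rational_step /sched_level /=.
by case: (schedule n) => l [|c] //=; rewrite addn1.
Qed.

Lemma sched_sep n : separated_children (sched_N n) (sched_D n) (sched_e n).
Proof.
rewrite /sched_N /sched_D /sched_e; case: ifP => _; first exact: sepQ.
exact: separated_children_digit.
Qed.

Lemma schedule_run n j : (j <= (schedule n).2)%N ->
  schedule (n + j) = ((schedule n).1 + j, (schedule n).2 - j)%N.
Proof.
elim: j => [|j IH] jc; first by rewrite !addn0 subn0; case: (schedule n).
rewrite addnS /= (IH (ltnW jc)).
have -> : ((schedule n).2 - j = ((schedule n).2 - j.+1).+1)%N by lia.
by rewrite addnS.
Qed.

Lemma exists_rational_step K : exists2 n, (K <= n)%N & is_rational_step n.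
Proof.
exists (K + (schedule K).2)%N; first exact: leq_addr.
by rewrite /is_rational_step schedule_run // subnn.
Qed.

Lemma sched_word_not1 (t : R) n j : is_rational_step n ->
  (j < sched_level n.+1 ^ 2)%N ->
  sched_word t (sched_level n.+1 + j) != 1%N :> nat.
Proof.
move=> rn jl; have sn : schedule n.+1 = (sched_level n.+1, (sched_level n.+1 ^ 2)%N).
  rewrite sched_levelS /sched_D rn /=.
  by move: rn; rewrite /is_rational_step /sched_level; case: (schedule n) => l [|c].
set L := sched_level n.+1 in jl sn *.
have run i : (i <= L ^ 2)%N -> schedule (n.+1 + i) = (L + i, L ^ 2 - i)%N.
  by move=> iL; rewrite schedule_run sn.
have notr : is_rational_step (n.+1 + j) = false.
  by rewrite /is_rational_step run ?(ltnW jl) //=; apply/eqP; lia.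
have lev : sched_level (n.+1 + j).+1 = (L + j).+1.
  by rewrite -addnS /sched_level run //= addnS.
rewrite /sched_word /= -lev (ternary_prefix_level (erefl : sched_level 0 = 0%N) sched_levelS sched_sep).
(* In a digit step the address is [3 * a + 2 * d] with [d < 2], so its last ternary digit is 0 or
   2. *)
rewrite [address _ _ _ _ _]/= /sched_D /sched_e notr expn1 -modnDml modnMl add0n.
have := radix_digit_lt sched_sep t (n.+1 + j); rewrite /sched_N notr.
by case: (radix_digit _ _ _) => [|[|]].
Qed.

(** At the end of a digit run, [L + L ^ 2] letters contain at most [L] letters 1, and
    [r * L <= L + L ^ 2] as soon as [r <= L]. *)
Lemma sched_word_frequency (t : R) r K : exists k, (K <= k)%N /\
  (r * \sum_(j < k) (sched_word t j == 1%N :> nat) <= k)%N.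
Proof.
have [n nK rn] := exists_rational_step (maxn r K).
set L := sched_level n.+1.
have nL : (n < L)%N := leq_level_id (erefl : sched_level 0 = 0%N) sched_levelS sched_sep n.+1.
have rL : (r <= L)%N by move: nK; rewrite geq_max => /andP[rn' _]; lia.
exists (L + L ^ 2)%N; split.
  by move: nK; rewrite geq_max => /andP[_ Kn]; lia.
rewrite big_split_ord /= [X in (_ + X)%N]big1 ?addn0; last first.
  by move=> j _; rewrite (negbTE (sched_word_not1 t rn (ltn_ord j))).
have : (\sum_(j < L) (sched_word t j == 1%N :> nat) <= L)%N.
  apply: (@leq_trans (\sum_(j < L) 1)%N); last by rewrite sum1_card card_ord.
  by apply: leq_sum => i _; case: eqP.
by move: (\sum_(j < L) _)%N => S; nia.
Qed.

Hypothesis approxQ : forall m a d (x : R), (a < 3 ^ m)%N -> (d < NQ m)%N ->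
  (a * 3 ^ DQ m + eQ m d)%:R <= x * 3 ^+ (m + DQ m) <= (a * 3 ^ DQ m + eQ m d).+1%:R ->
  exists pq, [/\ rat_index pq, cball (Defs.contract delta (rat_ball R pq)) x &
    `|x - pq.1%:R / pq.2%:R| <= 3 ^- (m + DQ m)].

Lemma sched_word_limsup (t : R) : limsup_rat_balls delta
  (coding R (sched_word t)).
Proof.
have l0 : sched_level 0 = 0%N by [].
apply: limsup_rat_balls_approx => eps eps0.
have [n nK rn] := exists_rational_step (Num.truncn eps^-1).+1.
have := address_bounds l0 sched_levelS sched_sep t n.+1.
have := radix_digit_lt sched_sep t n.
have := address_lt l0 sched_levelS sched_sep t n.
have := leq_level_id l0 sched_levelS sched_sep n.+1.
rewrite sched_levelS [address _ _ _ t n.+1]/= /sched_D /sched_e /sched_N rn.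
move=> nL aL dN /(approxQ aL dN) [pq [h1 h2 h3]].
exists pq; split => //; apply: le_trans h3 _.
rewrite -[leRHS]invrK lef_pV2 ?posrE ?invr_gt0 ?exprn_gt0 //.
apply: le_trans (ltW (truncnS_gt _)) _; rewrite -natrX ler_nat.
apply: leq_trans nK _; apply: leq_trans (ltnW (ltn_expl n (isT : 1 < 3)%N)) _.
by rewrite leq_exp2l // ltnW.
Qed.

Variable s : R.
Hypothesis s3 : 3 `^ s <= 2.
Hypothesis massQ : forall m, (3 ^+ (m + DQ m)) `^ s <= (NQ m)%:R.

Lemma sched_radix n : (3 ^+ sched_level n) `^ s <= (radix sched_N n)%:R.
Proof.
elim: n => [|n IH]; first by rewrite /radix big_ord0 expr0 powR1.
have rad1 : 1 <= (radix sched_N n)%:R :> R.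
  rewrite ler1n; apply: leq_trans (radix_ge sched_sep n).
  by rewrite expn_gt0.
rewrite sched_levelS /radix big_ord_recr natrM -/(radix _ n) /=.
rewrite /sched_N /sched_D; case: ifP => _.
  apply: le_trans (massQ _) _; rewrite -[leLHS]mul1r; exact: ler_wpM2r.
rewrite addn1 exprSr powRM ?exprn_ge0 //.
by apply: ler_pM; rewrite ?powR_ge0.
Qed.

End Machine.

Lemma hausdorff_measure_limsup_K0_neq0 (delta s s' : R) :
  1 <= delta -> 0 < s -> s * delta < 1 -> s <= ln 2 / ln 3 -> 0 <= s' <= s ->
  hausdorff_measure s' (limsup_rat_balls delta `&` K0 R) <> 0%E.
Proof.
move=> d1 s0 sd sln s's.
have s1 : s <= 1 by apply: ltW; apply: le_lt_trans sd; rewrite ler_peMr // ltW.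
have s3 : 3 `^ s <= 2.
  rewrite -ler_ln ?posrE ?powR_gt0 // ln_powR -ler_pdivlMr // ln_gt0 // ltr1n //.
pose step m (z : nat * nat * (nat -> nat)) := [/\ separated_children z.1.1 z.1.2 z.2,
    (3 ^+ (m + z.1.2)) `^ s <= z.1.1%:R &
    forall a d (x : R), (a < 3 ^ m)%N -> (d < z.1.1)%N ->
      (a * 3 ^ z.1.2 + z.2 d)%:R <= x * 3 ^+ (m + z.1.2) <= (a * 3 ^ z.1.2 + z.2 d).+1%:R ->
      exists pq, [/\ rat_index pq,
        cball (Defs.contract delta (rat_ball R pq)) x &
        `|x - pq.1%:R / pq.2%:R| <= 3 ^- (m + z.1.2)]].
have [z zP] : {z : nat -> nat * nat * (nat -> nat) & forall m, step m (z m)}.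
  apply: choice => m; have [N [D [e H]]] := rational_step m d1 s0 sd.
  by exists (N, D, e).
pose NQ m := (z m).1.1; pose DQ m := (z m).1.2; pose eQ m := (z m).2.
have sepQ m : separated_children (NQ m) (DQ m) (eQ m) by case: (zP m).
have massQ m : (3 ^+ (m + DQ m)) `^ s <= (NQ m)%:R by case: (zP m).
pose w := sched_word NQ DQ eQ.
have c0 : 0 < 2 * 32 `^ s :> R by rewrite mulr_gt0 ?powR_gt0.
apply: (@hausdorff_measure_holder R s s' _ _ (fun t => coding R (w t)) s0 s's c0).
  move=> t _; split.
    apply: sched_word_limsup => //= m a d x; by case: (zP m) => _ _; apply.
  apply/K0P; exists (w t) => // r K; exact: sched_word_frequency.
apply: coding_address_word_holder => //.
- exact: sched_levelS.
- exact: sched_sep.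
- by rewrite s0.
- exact: sched_radix.
Qed.

End LowerBound.

(** * The two bounds combined into the dimension formula *)

Theorem theorem2p16 (R : realType) (delta : R) (hdelta : 1 <= delta) :
  hausdorff_dim (limsup_rat_balls delta `&` K0 R) =
    (Num.min (ln 2 / ln 3) (1 / delta))%:E.
Proof.
have d0 : 0 < delta by apply: lt_le_trans hdelta.
have m0 : 0 < Num.min (ln 2 / ln 3) (1 / delta) :> R.
  by rewrite lt_min !divr_gt0 // ln_gt0 // ltr1n.
set M := Num.min _ _ in m0 *.
apply/eqP; rewrite eq_le; apply/andP; split.
  apply/lee_addgt0Pr => e e0; apply: ereal_inf_lbound.
  exists (M + e); last by rewrite EFinD.
  split; first by rewrite addr_ge0 // ltW.
  have : M < M + e by rewrite ltrDl.
  rewrite {1}/M gt_min => /orP[h|h].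
    exact: hausdorff_measure0S (@subIsetr _ _ _) (hausdorff_measure_K0 h).
  exact: hausdorff_measure0S (@subIsetl _ _ _) (hausdorff_measure_limsup_rat hdelta h).
apply: le_ereal_inf_tmp => _ [s [s0 Hs] <-]; rewrite lee_fin leNgt; apply/negP => sM.
(* The Hölder exponent [s1] lies strictly between [s] and [M]: it is positive even for [s = 0], and
   [s1 * delta < 1] is strict. *)
pose s1 := (s + M) / 2.
have s1M : s1 < M by rewrite /s1; lra.
move: (s1M); rewrite /M lt_min => /andP[h1 h2].
apply: (@hausdorff_measure_limsup_K0_neq0 R delta s1 s) Hs => //.
- by rewrite /s1; lra.
- by rewrite -ltr_pdivlMr.
- exact: ltW.
- by rewrite s0 /s1 /=; lra.
Qed.
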